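(* Let $\mathcal{Z}\subset\mathbb{R}^n$ be an open set homeomorphic to $\mathbb{R}^n$ and let $\mathcal{J}:\mathcal{Z}\to\mathbb{R}$ have a unique global minimizer $z^*\in\mathcal{Z}$. Consider the perturbed gradient descent $$z(k+1)=z(k)-\eta(k)\big(\nabla\mathcal{J}(z(k))+e(k)\big),\qquad k\in\mathbb{Z}_+,$$ with step sizes $\eta(k)>0$ and perturbation $e\in\ell_\infty^n$. If $\mathcal{J}$ is a proper objective function, with $L(h)$ denoting the Lipschitz constant of $\nabla\mathcal{J}$ over the sublevel set $\{z\in\mathcal{Z}:\mathcal{J}(z)\le h\}$, and the step size satisfies $0<\eta(k)\le\frac{1}{L(\mathcal{J}(z(k)))}$, then this system is small-disturbance input-to-state stable (with state $z$ and disturbance $e$).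
   Context: $\mathbb{R}_+=[0,\infty)$; $\mathbb{Z}_+$ is the set of nonnegative integers. $\ell_\infty^n$ is the set of bounded functions $w:\mathbb{Z}_+\to\mathbb{R}^n$, with $\|w\|_\infty=\sup_k\|w(k)\|$ (Euclidean norm). Comparison functions. $\alpha:\mathbb{R}_+\to\mathbb{R}_+$ is a $\mathcal{K}$-function if it is continuous, strictly increasing and $\alpha(0)=0$. For $d\in(0,\infty]$, $\alpha:[0,d)\to\mathbb{R}_+$ is a $\mathcal{K}_{[0,d)}$-function if it is continuous, strictly increasing and $\alpha(0)=0$. $\beta:\mathbb{R}_+\times\mathbb{R}_+\to\mathbb{R}_+$ is a $\mathcal{KL}$-function if $\beta(\cdot,t)$ is a $\mathcal{K}$-function for each fixed $t\ge0$ and, for each fixed $r\ge0$, $\beta(r,\cdot)$ is decreasing (in the non-strict sense) and tends to $0$ as $t\to\infty$. Size function. For an open set $\mathcal{S}\subset\mathbb{R}^n$ and $\chi^*\in\mathcal{S}$, $\mathcal{V}:\mathcal{S}\to\mathbb{R}_+$ is a size function for $(\mathcal{S},\chi^* )$ if it is continuous; positive definite with respect to $\chi^*$ ($\mathcal{V}(\chi^* )=0$, $\mathcal{V}(\chi)>0$ for $\chi\ne\chi^*$); and coercive (for any sequence $\{\chi_k\}$ in $\mathcal{S}$ with $\chi_k\to\partial\mathcal{S}$ or $\|\chi_k\|\to\infty$, $\mathcal{V}(\chi_k)\to\infty$). Proper objective function. A continuously differentiable $\mathcal{J}:\mathcal{Z}\to\mathbb{R}$ is a proper objective function if: (1) $\mathcal{J}(z)-\mathcal{J}(z^*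 )$ is a size function for $(\mathcal{Z},z^* )$; (2) $\nabla\mathcal{J}$ is Lipschitz continuous over each sublevel set $\mathcal{Z}(h)=\{z\in\mathcal{Z}:\mathcal{J}(z)\le h\}$, i.e. $\|\nabla\mathcal{J}(z_1)-\nabla\mathcal{J}(z_2)\|\le L(h)\|z_1-z_2\|$ for all $z_1,z_2\in\mathcal{Z}(h)$; (3) ($\mathcal{K}$-PL estimate) there exists a $\mathcal{K}$-function $\alpha_5$ such that $\|\nabla\mathcal{J}(z)\|\ge\alpha_5(\mathcal{J}(z)-\mathcal{J}(z^* ))$ for all $z\in\mathcal{Z}$. Small-disturbance ISS. A discrete-time system with state $\chi(k)\in\mathcal{S}$, equilibrium $\chi^*$ of the unforced system and disturbance $w$ is small-disturbance input-to-state stable (ISS) if there exist a size function $\mathcal{V}$ for $(\mathcal{S},\chi^* )$, a constant $d>0$ (possibly $\infty$), a $\mathcal{KL}$-function $\beta$ and a $\mathcal{K}_{[0,d)}$-function $\gamma$ such that for all inputs $w$ with $\|w\|_\infty<d$ and all initial states $\chi(0)\in\mathcal{S}$, $\chi(k)$ remains in $\mathcal{S}$ and $\mathcal{V}(\chi(k))\le\beta(\mathcal{V}(\chi(0)),k)+\gamma(\|w\|_\infty)$ for all $k\in\mathbb{Z}_+$. Here it is applied with $\mathcal{S}=\mathcal{Z}$, $\chi=z$, $\chi^*=z^*$, $w=e$.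
   Formalization: Added to exclude counterexamples: on each sublevel set of J the step sizes η(k) have a lower bound, depending only on k and the level, with divergent sum; L(h) is any Lipschitz constant that is positive and nondecreasing for h ≥ J(z* ). *)

(* Defs.v *)
From HB Require Import structures.
From mathcomp Require Import all_boot all_order all_algebra.
From mathcomp Require Import all_classical all_reals all_analysis.

Set Implicit Arguments.
Unset Strict Implicit.
Unset Printing Implicit Defensive.

Import Order.TTheory GRing.Theory Num.Theory numFieldNormedType.Exports.

Local Open Scope classical_set_scope.
Local Open Scope ring_scope.

(* The library norm on matrices is the maximum norm, hence this one; the two
   induce the same topology. *)
Definition enorm (R : realType) (n : nat) (x : 'rV[R]_n) : R :=
  Num.sqrt (\sum_(i < n) x ord0 i ^+ 2).

Definition linf (R : realType) (n : nat) (w : nat -> 'rV[R]_n) : Prop :=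
  has_ubound (range (fun k => enorm (w k))).

Definition linf_norm (R : realType) (n : nat) (w : nat -> 'rV[R]_n) : R :=
  sup (range (fun k => enorm (w k))).

(* Functions on [0, d) are total functions whose values outside [0, d) are
   irrelevant; nonnegativity on [0, d) follows from the last two clauses.
   The K-functions are the case d = +oo. *)
Definition class_K_on (R : realType) (d : \bar R) (a : R -> R) : Prop :=
  [/\ {within [set r | 0 <= r /\ (r%:E < d)%E], continuous a},
      forall r s, 0 <= r -> r < s -> (s%:E < d)%E -> a r < a s
    & a 0 = 0].

Definition class_K (R : realType) (a : R -> R) : Prop := class_K_on +oo%E a.

Definition class_KL (R : realType) (b : R -> R -> R) : Prop :=
  [/\ forall t, 0 <= t -> class_K (b ^~ t),
      forall r s t, 0 <= r -> 0 <= s -> s <= t -> b r t <= b r s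
    & forall r, 0 <= r -> b r t @[t --> +oo] --> 0].

Definition bdry (T : topologicalType) (S : set T) : set T :=
  closure S `\` interior S.

(* No sequence tends to an empty boundary. *)
Definition tends_to_bdry (R : realType) (n : nat) (S : set 'rV[R]_n)
    (x : nat -> 'rV[R]_n) : Prop :=
  forall eps : R, 0 < eps ->
    \forall k \near \oo, exists2 y, bdry S y & enorm (x k - y) < eps.

Definition size_function (R : realType) (n : nat) (S : set 'rV[R]_n)
    (xs : 'rV[R]_n) (V : 'rV[R]_n -> R) : Prop :=
  [/\ {within S, continuous V},
      V xs = 0,
      forall x, S x -> x <> xs -> 0 < V x
    & forall x : nat -> 'rV[R]_n, (forall k, S (x k)) ->
        tends_to_bdry S x \/ enorm (x k) @[k --> \oo] --> +oo ->
        V (x k) @[k --> \oo] --> +oo].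

Definition grad (R : realType) (n : nat) (J : 'rV[R]_n -> R) (z : 'rV[R]_n) :
    'rV[R]_n :=
  \row_(i < n) 'D_(delta_mx ord0 i) J z.

Definition sublevel (R : realType) (n : nat) (Z : set 'rV[R]_n)
    (J : 'rV[R]_n -> R) (h : R) : set 'rV[R]_n :=
  [set z | Z z /\ J z <= h].

Definition sublevel_lipschitz (R : realType) (n : nat) (Z : set 'rV[R]_n)
    (J : 'rV[R]_n -> R) (L : R -> R) : Prop :=
  forall h z1 z2, sublevel Z J h z1 -> sublevel Z J h z2 ->
    enorm (grad J z1 - grad J z2) <= L h * enorm (z1 - z2).

Definition C1_on (R : realType) (n : nat) (Z : set 'rV[R]_n)
    (J : 'rV[R]_n -> R) : Prop :=
  (forall z, Z z -> differentiable J z) /\ {within Z, continuous (grad J)}.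

Definition proper_objective (R : realType) (n : nat) (Z : set 'rV[R]_n)
    (zs : 'rV[R]_n) (J : 'rV[R]_n -> R) : Prop :=
  [/\ C1_on Z J,
      size_function Z zs (fun z => J z - J zs),
      exists L : R -> R, sublevel_lipschitz Z J L
    & exists2 a5 : R -> R, class_K a5 &
        forall z, Z z -> a5 (J z - J zs) <= enorm (grad J z)].

Definition homeomorphic_to_Rn (R : realType) (n : nat) (Z : set 'rV[R]_n) :
    Prop :=
  exists (f g : 'rV[R]_n -> 'rV[R]_n),
    [/\ {within Z, continuous f}, continuous g, forall y, Z (g y),
        forall x, Z x -> g (f x) = x & cancel g f].

Definition global_minimizer (R : realType) (n : nat) (Z : set 'rV[R]_n)
    (J : 'rV[R]_n -> R) (z : 'rV[R]_n) : Prop :=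
  Z z /\ forall y, Z y -> J z <= J y.

Definition unique_global_minimizer (R : realType) (n : nat) (Z : set 'rV[R]_n)
    (J : 'rV[R]_n -> R) (zs : 'rV[R]_n) : Prop :=
  global_minimizer Z J zs /\ forall z, global_minimizer Z J z -> z = zs.

(* A system is given by its runs: [run x w] says that the state sequence x is
   generated by the disturbance w. Runs are sequences in the ambient space, so
   that staying in S is part of the conclusion. *)
Definition small_disturbance_ISS (R : realType) (n m : nat)
    (S : set 'rV[R]_n) (xs : 'rV[R]_n)
    (run : (nat -> 'rV[R]_n) -> (nat -> 'rV[R]_m) -> Prop) : Prop :=
  exists (V : 'rV[R]_n -> R) (d : \bar R) (b : R -> R -> R) (g : R -> R),
    [/\ size_function S xs V, (0 < d)%E, class_KL b, class_K_on d g &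
        forall x w, run x w -> S (x 0%N) ->
          linf w -> ((linf_norm w)%:E < d)%E ->
          forall k : nat, S (x k) /\
            V (x k) <= b (V (x 0%N)) k%:R + g (linf_norm w)].

(* Runs of the perturbed gradient descent, for any admissible step sizes,
   chosen along the run in any way. The upper bound on eta k binds only while
   z k is in Z, where J is meaningful. The lower bound: as long as the run has
   stayed in the sublevel set of h, eta k is at least etamin h k. *)
Definition perturbed_GD (R : realType) (n : nat) (Z : set 'rV[R]_n)
    (J : 'rV[R]_n -> R) (L : R -> R) (etamin : R -> nat -> R)
    (z e : nat -> 'rV[R]_n) : Prop :=
  exists eta : nat -> R,
    [/\ forall k, z k.+1 = z k - eta k *: (grad J (z k) + e k),
        forall k, 0 < eta k,
        forall k, Z (z k) -> eta k <= 1 / L (J (z k))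
      & forall h k, (forall j, (j <= k)%N -> sublevel Z J h (z j)) ->
          etamin h k <= eta k].

(* Without this the step sizes may be summable, and the iterates then need not
   converge even when e = 0: J z = z ^ 2 / 2 on the line, eta k = 2 ^- (k + 2).
   It holds for step sizes bounded away from 0 on each sublevel set, and for
   any sequence eta with divergent sum (take etamin h = eta). *)
Definition nonsummable_on_sublevels (R : realType) (hmin : R)
    (etamin : R -> nat -> R) : Prop :=
  forall h, hmin <= h -> series (etamin h) @ \oo --> +oo.

(* Main.v *)
Require Import Defs.
From HB Require Import structures.
From mathcomp Require Import all_boot all_order all_algebra.
From mathcomp Require Import all_classical all_reals all_analysis.
From mathcomp Require Import ring lra.
Set Implicit Arguments.
Unset Strict Implicit.
Unset Printing Implicit Defensive.

Import Order.TTheory GRing.Theory Num.Theory numFieldNormedType.Exports.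
Local Open Scope classical_set_scope.
Local Open Scope ring_scope.

(** The size function is the optimality gap V = J - J(zs).

    One step. Write g for the gradient at z, e for the disturbance and
    u = g + e for the direction of the step. As long as the ray z - s u stays
    in a sublevel set of h, the Lipschitz bound on the gradient gives
    J(z - s u) <= J(z) - s <g, u> + L(h) s^2 |u|^2 / 2, and if the right-hand
    side stays below h then the ray cannot leave the sublevel set
    ([ray_descent]). This is used with two values of h.

    - If |e| < |g|, take h = J(z). As s <= 1 / L(h), polarization bounds the
      right-hand side by J(z) - s (|g|^2 - |e|^2) / 2, so V decreases by a
      definite amount ([gd_step_large_gradient]).
    - If |g| <= |e|, the PL estimate makes V(z) small, and the step is short
      because s <= 1 / L(J(zs)). With h = J(zs) + 1 the gap grows by at most a
      multiple C |e|^2, provided e is small ([gd_step_small_gradient]); here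
      the bound d on admissible disturbances arises.

    With p the inverse of half the PL function a5 and
    gamma(m) = p(m) + C m^2, both cases give for |e| <= m
    ([perturbed_gd_step]): V never exceeds the larger of gamma(m) and its
    previous value, and while V > gamma(m) one has |g| >= a5(V) > 2 |e|, so
    that V decreases by at least 3/8 eta a5(V)^2.

    Runs. A run with V(z(0)) <= r therefore stays in the sublevel set of
    h = J(zs) + r + 1, so its step sizes are at least etamin h. Their sum
    diverges, so V falls below max(eps, gamma(m)) within a number of steps
    that depends on r and eps only ([decrease_to_threshold]). Thus
    V(z(k)) - gamma(m) is at most V(z(0)) and becomes small uniformly over
    V(z(0)) <= r; a regularized supremum of it over all runs is the
    KL-function ([class_KL_majorant]). *)

(** * Euclidean inner product *)

Definition dotp (R : realType) (n : nat) (x y : 'rV[R]_n) : R :=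
  \sum_(i < n) x ord0 i * y ord0 i.

Lemma dotpC (R : realType) (n : nat) (x y : 'rV[R]_n) : dotp x y = dotp y x.
Proof. by apply: eq_bigr => i _; rewrite mulrC. Qed.

Lemma dotpDl (R : realType) (n : nat) (x y w : 'rV[R]_n) :
  dotp (x + y) w = dotp x w + dotp y w.
Proof. by rewrite -big_split; apply: eq_bigr => i _; rewrite mxE mulrDl. Qed.

Lemma dotpZl (R : realType) (n : nat) (a : R) (x y : 'rV[R]_n) :
  dotp (a *: x) y = a * dotp x y.
Proof. by rewrite mulr_sumr; apply: eq_bigr => i _; rewrite mxE mulrA. Qed.

Lemma dotpNl (R : realType) (n : nat) (x y : 'rV[R]_n) :
  dotp (- x) y = - dotp x y.
Proof. by rewrite -scaleN1r dotpZl mulN1r. Qed.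

Lemma dotpDr (R : realType) (n : nat) (w x y : 'rV[R]_n) :
  dotp w (x + y) = dotp w x + dotp w y.
Proof. by rewrite dotpC dotpDl !(dotpC w). Qed.

Lemma dotpZr (R : realType) (n : nat) (a : R) (x y : 'rV[R]_n) :
  dotp y (a *: x) = a * dotp y x.
Proof. by rewrite dotpC dotpZl dotpC. Qed.

Lemma dotpNr (R : realType) (n : nat) (x y : 'rV[R]_n) :
  dotp y (- x) = - dotp y x.
Proof. by rewrite dotpC dotpNl dotpC. Qed.

Lemma dotp_ge0 (R : realType) (n : nat) (x : 'rV[R]_n) : 0 <= dotp x x.
Proof. by apply: sumr_ge0 => i _; rewrite -expr2 sqr_ge0. Qed.

Lemma enorm_ge0 (R : realType) (n : nat) (x : 'rV[R]_n) : 0 <= enorm x.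
Proof. exact: sqrtr_ge0. Qed.

Lemma enorm_sqr (R : realType) (n : nat) (x : 'rV[R]_n) :
  enorm x ^+ 2 = dotp x x.
Proof.
rewrite sqr_sqrtr; first by apply: eq_bigr => i _; rewrite expr2.
by apply: sumr_ge0 => i _; exact: sqr_ge0.
Qed.

Lemma enormZ (R : realType) (n : nat) (a : R) (x : 'rV[R]_n) :
  enorm (a *: x) = `|a| * enorm x.
Proof.
apply/eqP; rewrite -(@eqrXn2 _ 2%N) ?mulr_ge0 ?enorm_ge0 //.
by rewrite exprMn !enorm_sqr dotpZl dotpZr real_normK ?num_real// mulrA expr2.
Qed.

Lemma CauchySchwarz_dotp (R : realType) (n : nat) (x y : 'rV[R]_n) :
  dotp x y <= enorm x * enorm y.
Proof.
have [a0 b0] := (enorm_ge0 x, enorm_ge0 y).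
have := dotp_ge0 (enorm y *: x - enorm x *: y).
rewrite dotpDl dotpNl !dotpDr !dotpNr !dotpZl !dotpZr -!enorm_sqr (dotpC y x).
have [ab0 le0|] := ltP 0 (enorm x * enorm y); first by nra.
move=> ab0 _; have {ab0} /eqP : enorm x * enorm y = 0 by nra.
have dotp0 (v w : 'rV[R]_n) : enorm v = 0 -> dotp v w = 0.
  move=> v0; have /eqP := enorm_sqr v; rewrite v0 expr0n/= eq_sym psumr_eq0.
    move=> /allP v_0; rewrite /dotp big1// => i _.
    by have := v_0 i (mem_index_enum _); rewrite /= mulf_eq0 orbb => /eqP ->;
      rewrite mul0r.
  by move=> i _; rewrite -expr2 sqr_ge0.
by rewrite mulf_eq0 => /orP[]/eqP e0;
  rewrite e0 ?(dotp0 _ _ e0) ?mul0r// dotpC dotp0// mulr0.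
Qed.

(** The error enters the descent estimate only through |g|^2 - |e|^2; moreover
    J decreases initially along - (g + e) as soon as |e| < |g|. *)
Lemma dotp_polar (R : realType) (n : nat) (g e : 'rV[R]_n) :
  2 * dotp g (g + e) = enorm (g + e) ^+ 2 + enorm g ^+ 2 - enorm e ^+ 2.
Proof. rewrite !enorm_sqr !(dotpDl, dotpDr) (dotpC e g); ring. Qed.

Lemma enormD_sqr_le (R : realType) (n : nat) (g e : 'rV[R]_n) :
  enorm (g + e) ^+ 2 <= 2 * (enorm g ^+ 2 + enorm e ^+ 2).
Proof.
have := dotp_ge0 (g - e).
by rewrite !enorm_sqr !(dotpDl, dotpDr, dotpNl, dotpNr) (dotpC e g); lra.
Qed.

(** * Descent along a ray *)

Lemma derive_dotp_grad (R : realType) (n : nat) (J : 'rV[R]_n -> R)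
    (z v : 'rV[R]_n) :
  differentiable J z -> 'D_v J z = dotp (grad J z) v.
Proof.
move=> dJ; rewrite deriveE// {1}(row_sum_delta v) linear_sum/=.
apply: eq_bigr => i _; rewrite linearZ/= -deriveE// mxE.
by rewrite mulrC.
Qed.

(** Induction along an interval: by completeness the supremum of the initial
    segments on which P holds is itself such a segment, and the right
    neighbourhood condition pushes it to t. *)
Lemma real_induction (R : realType) (t : R) (P : R -> Prop) :
  P 0 ->
  (forall s, 0 <= s -> s < t -> (forall r, 0 <= r -> r <= s -> P r) ->
    \forall r \near s^'+, P r) ->
  (forall s, 0 < s -> s <= t -> (forall r, 0 <= r -> r < s -> P r) -> P s) ->
  forall s, 0 <= s -> s <= t -> P s.
Proof.
move=> P0 Popen Pclosed s s0 st.
pose A := [set a | [/\ 0 <= a, a <= t & forall r, 0 <= r -> r <= a -> P r]].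
have t0 : 0 <= t := le_trans s0 st.
have A0 : A 0.
  by split=> // r r0 rle0; have -> : r = 0 by apply/eqP; rewrite eq_le r0 rle0.
have ubA : has_ubound A by exists t => a [].
have supA : has_sup A by split=> //; exists 0.
have c0 : 0 <= sup A by exact: ub_le_sup.
have ct : sup A <= t by apply: ge_sup; [exists 0|move=> a []].
have ltcP r : 0 <= r -> r < sup A -> P r.
  move=> r0 rc; have [a [_ _ aP] ra] : exists2 a, A a & r < a.
    exact: sup_gt supA.1 rc.
  by apply: aP => //; exact: ltW.
have Ac : A (sup A).
  split=> // r r0; rewrite le_eqVlt => /orP[/eqP ->|]; last exact: ltcP.
  move: c0; rewrite le_eqVlt => /orP[/eqP <- //|c0].
  exact: Pclosed.
have [ct'|tc] := ltP (sup A) t; last first.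
  by case: Ac => _ _; apply => //; exact: le_trans st tc.
have /nbhs_ballP[e /= e0 eP] := Popen _ c0 ct' (let: And3 _ _ x := Ac in x).
pose d := Num.min (e / 2) (t - sup A).
have d0 : 0 < d by rewrite lt_min divr_gt0//= subr_gt0.
have Ad : A (sup A + d).
  split; [by rewrite addr_ge0// ltW| |move=> r r0 rd].
    by rewrite -lerBrDl ge_min lexx orbT.
  have [rc|cr] := leP r (sup A).
    by case: Ac => _ _; exact.
  apply: eP => //; rewrite /ball/= ltr0_norm ?subr_lt0// opprB.
  have : d <= e / 2 by rewrite ge_min lexx.
  move: rd e0; set c := sup A; lra.
have := ub_le_sup ubA Ad; move: d0; set c := sup A; lra.
Qed.

Lemma continuous_ray (R : realType) (n : nat) (z u : 'rV[R]_n) :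
  continuous (fun r : R => z - r *: u).
Proof.
move=> r; apply: cvgB; first exact: cvg_cst.
by apply: cvgZl; exact: cvg_id.
Qed.

(** Coercivity is what prevents a ray from reaching the boundary: it would be
    approached along the ray, where V stays bounded. *)
Lemma size_function_ray_closed (R : realType) (n : nat) (S : set 'rV[R]_n)
    (xs : 'rV[R]_n) (V : 'rV[R]_n -> R) (z u : 'rV[R]_n) (c s : R) :
  open S -> size_function S xs V -> 0 < s ->
  (forall r, 0 <= r -> r < s -> S (z - r *: u) /\ V (z - r *: u) <= c) ->
  S (z - s *: u) /\ V (z - s *: u) <= c.
Proof.
move=> Sopen [Vcont _ _ Vcoer] s0 ray.
(* A sequence of parameters strictly below s, so that its points are in S. *)
pose sk (k : nat) : R := s - s * k.+1%:R^-1.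
have sk_s : sk k @[k --> \oo] --> s.
  rewrite -[X in _ --> X]subr0; apply: cvgB; first exact: cvg_cst.
  rewrite -(mulr0 s); apply: cvgM; first exact: cvg_cst.
  exact: cvg_harmonic.
have xk_y : (z - sk k *: u) @[k --> \oo] --> (z - s *: u).
  exact: cvg_comp sk_s (@continuous_ray R n z u s).
have skP k : S (z - sk k *: u) /\ V (z - sk k *: u) <= c.
  apply: ray; rewrite /sk.
    by rewrite subr_ge0 ler_piMr ?(ltW s0)// invf_le1 ?ler1n.
  by rewrite ltrBlDr ltrDl mulr_gt0// invr_gt0.
have Sy : S (z - s *: u).
  apply: contrapT => nSy.
  have /cvgryPge/(_ (c + 1)) [N _ /(_ N (leqnn _))] :
      V (z - sk k *: u) @[k --> \oo] --> +oo.
    apply: Vcoer => [k|]; first exact: (skP k).1.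
    left=> eps eps0; near=> k; exists (z - s *: u).
      split; last by move=> /interior_subset.
      move=> B /xk_y [N _ NB]; exists (z - sk N *: u).
      by split; [exact: (skP N).1|exact: (NB N (leqnn N))].
    have -> : z - sk k *: u - (z - s *: u) = (s - sk k) *: u.
      by rewrite [RHS]scalerBl opprB addrC addrA subrK.
    rewrite enormZ; near: k.
    have : `|s - sk k| * enorm u @[k --> \oo] --> `|s - s| * enorm u.
      apply: cvgM; last exact: cvg_cst.
      by apply: cvg_norm; apply: cvgB => //; exact: cvg_cst.
    by rewrite subrr normr0 mul0r => /cvgr_lt; exact.
  by have := (skP N).2; rewrite /=; lra.
split=> //; rewrite leNgt; apply/negP => cV.
have Vy : V x @[x --> z - s *: u] --> V (z - s *: u).
  by move: Vcont; rewrite continuous_open_subspace//; apply; rewrite inE.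
have : V (z - sk k *: u) @[k --> \oo] --> V (z - s *: u).
  exact: cvg_comp xk_y Vy.
move=> /cvgr_gt/(_ _ cV)[N _ /(_ N (leqnn _))] /=.
by rewrite ltNge (skP N).2.
Unshelve. all: by end_near. Qed.

(** The difference quotients of the restriction to the ray are those of the
    directional derivative along - u. *)
Lemma is_derive_ray (R : realType) (n : nat) (J : 'rV[R]_n -> R)
    (z u : 'rV[R]_n) (r : R) :
  differentiable J (z - r *: u) ->
  is_derive r 1 (fun s : R => J (z - s *: u)) (- dotp (grad J (z - r *: u)) u).
Proof.
move=> dJ.
have quotE : (fun h : R => h^-1 *: (J (z - (h *: (1 : R) + r) *: u) -
                                    J (z - r *: u))) =
    (fun h : R => h^-1 *: (J (h *: - u + (z - r *: u)) - J (z - r *: u))).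
  apply/funext => h; congr (_ *: (J _ - _)).
  by rewrite scalerDl opprD addrCA scalerN /GRing.scale/= mulr1.
split.
  by rewrite /derivable quotE; exact: diff_derivable.
by rewrite -dotpNr -derive_dotp_grad// /derive quotE.
Qed.

(** The descent lemma. Only the points of the ray are compared with z, so that
    the sublevel set need not be convex. The mean value theorem is applied to
    the difference of both sides, whose derivative is nonpositive by
    Cauchy-Schwarz. *)
Lemma ray_quadratic_bound (R : realType) (n : nat) (J : 'rV[R]_n -> R)
    (z u : 'rV[R]_n) (l s : R) :
  0 <= s ->
  (forall r, 0 <= r -> r <= s -> differentiable J (z - r *: u)) ->
  (forall r, 0 <= r -> r <= s ->
    enorm (grad J z - grad J (z - r *: u)) <= l * (r * enorm u)) ->
  J (z - s *: u) <=
    J z - s * dotp (grad J z) u + l * (s ^+ 2 / 2) * enorm u ^+ 2.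
Proof.
move=> s0 dJ lipJ; have := s0; rewrite le_eqVlt => /orP[/eqP <-|s_gt0].
  by rewrite scale0r subr0 expr0n/= !(mul0r, mulr0) subr0 addr0.
(* The negative of the change allowed by the bound. *)
pose q (r : R) : R := r * dotp (grad J z) u - l * (r ^+ 2 / 2) * enorm u ^+ 2.
pose psi := (fun r : R => J (z - r *: u)) \+ q.
pose dpsi (r : R) : R := - dotp (grad J (z - r *: u)) u +
  (dotp (grad J z) u - l * r * enorm u ^+ 2).
have dq (r : R) : is_derive r 1 q (dotp (grad J z) u - l * r * enorm u ^+ 2).
  have -> : q = (dotp (grad J z) u *: (@id R)) -
                 ((l / 2 * enorm u ^+ 2) *: ((@id R) ^+ 2)).
    by apply/funext => x; rewrite /q !fctE /GRing.scale/=; field.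
  by apply: is_derive_eq; rewrite /GRing.scale/= expr1; field.
have dpsiP (r : R) : 0 <= r -> r <= s -> is_derive r 1 psi (dpsi r).
  by move=> r0 rs; apply: is_deriveD; apply: is_derive_ray; exact: dJ.
have [||c] := @MVT R psi dpsi 0 s s_gt0.
- by move=> x; rewrite in_itv/= => /andP[x0 xs]; apply: dpsiP; exact: ltW.
- apply: derivable_within_continuous => x; rewrite in_itv/= => /andP[x0 xs].
  by have [] := dpsiP x x0 xs.
rewrite in_itv/= => /andP[c0 cs].
have dpsi_le0 : dpsi c <= 0.
  have := CauchySchwarz_dotp (grad J z - grad J (z - c *: u)) u.
  have := lipJ c (ltW c0) (ltW cs); rewrite dotpDl dotpNl /dpsi.
  by have := enorm_ge0 u; nra.
rewrite /psi/q /= scale0r !subr0; nra.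
Qed.

(** The quadratic bound needs the ray to lie in the sublevel set, and the bound
    being below h keeps it there: real induction resolves the circularity.
    When J z = h the bound is not strict at 0, and the start is secured by the
    negative slope of J along the ray. *)
Lemma ray_descent (R : realType) (n : nat) (Z : set 'rV[R]_n)
    (J : 'rV[R]_n -> R) (zs : 'rV[R]_n) (L : R -> R) (h : R)
    (z u : 'rV[R]_n) (t : R) :
  open Z -> (forall x, Z x -> differentiable J x) ->
  size_function Z zs (fun x => J x - J zs) -> sublevel_lipschitz Z J L ->
  sublevel Z J h z -> 0 <= t ->
  (forall s, 0 < s -> s <= t ->
    J z - s * dotp (grad J z) u + L h * (s ^+ 2 / 2) * enorm u ^+ 2 < h) ->
  J z < h \/ 0 < dotp (grad J z) u ->
  sublevel Z J h (z - t *: u) /\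
  J (z - t *: u) <=
    J z - t * dotp (grad J z) u + L h * (t ^+ 2 / 2) * enorm u ^+ 2.
Proof.
move=> Zopen dJ Vsize Llip zh t0 qlt start.
have bound (s : R) : 0 <= s ->
    (forall r, 0 <= r -> r <= s -> sublevel Z J h (z - r *: u)) ->
    J (z - s *: u) <=
    J z - s * dotp (grad J z) u + L h * (s ^+ 2 / 2) * enorm u ^+ 2.
  move=> s0 ray; apply: ray_quadratic_bound => // r r0 rs.
    by apply: dJ; have [] := ray r r0 rs.
  have -> : r * enorm u = enorm (z - (z - r *: u)).
    by rewrite subKr enormZ ger0_norm.
  by apply: Llip => //; exact: ray.
have all_in : forall s : R, 0 <= s -> s <= t -> sublevel Z J h (z - s *: u).
  apply: (@real_induction R t (fun s => sublevel Z J h (z - s *: u))).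
  - by rewrite scale0r subr0.
  - move=> s s0 st ray.
    have [Zs Jsh] := ray s s0 (lexx s).
    have nearZ : \forall r \near s^'+, Z (z - r *: u).
      apply: cvg_within; apply: (@continuous_ray R n z u s).
      by rewrite /= nbhsE; exists Z.
    suff nearJ : \forall r \near s^'+, J (z - r *: u) <= h.
      by near=> r; split; near: r.
    have nearJlt : J (z - s *: u) < h ->
        \forall r \near s^'+, J (z - r *: u) <= h.
      move=> Jlt; apply: cvg_within.
      have Jray : J (z - r *: u) @[r --> s] --> J (z - s *: u).
        apply: (@continuous_comp _ _ _ (fun r : R => z - r *: u) J).
          exact: continuous_ray.
        by apply: differentiable_continuous; exact: dJ.
      by move/cvgr_lt : Jray => /(_ _ Jlt); apply: filterS => r /ltW.
    have := s0; rewrite le_eqVlt => /orP[/eqP s_0|s_gt0]; last first.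
      by apply: nearJlt; apply: le_lt_trans (bound s s0 ray) _;
        exact: qlt (ltW st).
    case: start => [Jlt|gu].
      by apply: nearJlt; rewrite -s_0 scale0r subr0.
    rewrite -s_0.
    have dJz := dJ z zh.1.
    have : h^-1 *: (J (h *: - u + z) - J z) @[h --> 0^'] --> 'D_(- u) J z.
      exact: diff_derivable.
    rewrite derive_dotp_grad// dotpNr => /cvg_dnbhs_at_right/cvgr_lt/(_ 0).
    rewrite oppr_lt0 => /(_ gu) quot_lt0.
    near=> r.
    have r0 : 0 < r by near: r; exact: nbhs_right_gt.
    have : r^-1 * (J (r *: - u + z) - J z) < 0 by near: r.
    rewrite pmulr_rlt0 ?invr_gt0// scalerN (addrC _ z) subr_lt0.
    by move=> /ltW/le_trans; apply; case: zh.
  - move=> s s0 st ray.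
    have [|Zs Js] := @size_function_ray_closed _ _ _ _ _ z u (h - J zs) s
      Zopen Vsize s0.
      by move=> r r0 rs; have [Zr Jr] := ray r r0 rs; rewrite lerD2r.
    by split=> //; rewrite lerD2r in Js.
split; first exact: all_in.
apply: bound => // r r0 rt; exact: all_in.
Unshelve. all: by end_near. Qed.

(** * Comparison functions *)

Lemma class_K_mono (R : realType) (a : R -> R) (r s : R) :
  class_K a -> 0 <= r -> 0 <= s -> (a r <= a s) = (r <= s).
Proof.
move=> [_ aincr _] r0 s0; apply/idP/idP => [|]; last first.
  by rewrite le_eqVlt => /orP[/eqP -> //|rs]; apply/ltW/aincr; rewrite ?ltry.
by apply: contraTT; rewrite -!ltNge => sr; apply: aincr; rewrite ?ltry.
Qed.

(** A K-function may be bounded, so an inverse exists on an initial interval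
    only. *)
Lemma class_K_inverse (R : realType) (a : R -> R) (c : R) :
  class_K a -> 0 < c ->
  exists2 p : R -> R, class_K_on (a c)%:E p &
    forall m, 0 <= m -> m < a c -> [/\ 0 <= p m, p m <= c & a (p m) = m].
Proof.
move=> aK c0; have [acont aincr a0] := aK.
have acont_c : {within `[0, c], continuous a}.
  apply: continuous_subspaceW acont => x /=; rewrite in_itv/= => /andP[x0 _].
  by rewrite ltry.
have ainj : {in `[0, c] &, injective a}.
  move=> x y; rewrite !in_itv/= => /andP[x0 _] /andP[y0 _] axy.
  apply/eqP; rewrite eq_le -(class_K_mono aK x0 y0).
  by rewrite -(class_K_mono aK y0 x0) axy lexx.
pose p := 'pinv_(fun=> 0) `[0, c] a.
have pa : {in `[0, c], cancel a p}.
  move=> x xc; apply: pinvKV; rewrite ?inE// => y z.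
  by rewrite !inE; exact: ainj.
have ap : forall m, 0 <= m -> m <= a c -> [/\ 0 <= p m, p m <= c & a (p m) = m].
  move=> m m0 mac.
  have ac0 : a 0 <= a c by rewrite class_K_mono// ltW.
  have [|x /= xc <-] := @segment_continuous_le_surjective R 0 c a
    (ltW c0) ac0 acont_c m.
    by rewrite /= in_itv/= a0 m0.
  by rewrite pa//; move: xc; rewrite in_itv/= => /andP[].
exists p; last by move=> m m0 mac; apply: ap => //; exact: ltW.
split.
- have := segment_can_le_continuous (ltW c0) acont_c pa; rewrite a0.
  apply: continuous_subspaceW => x /= []; rewrite lte_fin in_itv/= => -> xac.
  exact: ltW.
- move=> r s r0 rs; rewrite lte_fin => sac.
  have s0 : 0 <= s by exact: le_trans r0 (ltW rs).
  have [pr0 _ apr] := ap r r0 (ltW (lt_trans rs sac)).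
  have [ps0 _ aps] := ap s s0 (ltW sac).
  by rewrite ltNge -(class_K_mono aK)// apr aps -ltNge.
- by rewrite -{1}a0; apply: pa; rewrite in_itv/= lexx ltW.
Qed.

Lemma lipschitz_within_continuous (R : realType) (A : set R) (f : R -> R)
    (l : R) :
  (forall x y, A x -> A y -> x <= y -> `|f y - f x| <= l * (y - x)) ->
  {within A, continuous f}.
Proof.
move=> lip; apply/subspace_continuousP => x Ax; apply/cvgrPdist_lt => eps eps0.
have lip' y : A y -> `|f x - f y| <= `|l| * `|x - y|.
  move=> Ay; have [xy|yx] := leP x y.
    rewrite distrC (distrC x); apply: le_trans (lip _ _ Ax Ay xy) _.
    by rewrite -normrM ler_norm.
  by apply: le_trans (lip _ _ Ay Ax (ltW yx)) _; rewrite -normrM ler_norm.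
rewrite /= near_withinE; near=> y => Ay.
apply: le_lt_trans (lip' y Ay) _.
have : `|x - y| < eps / (`|l| + 1).
  near: y; have /cvgrPdist_lt := @cvg_id _ (nbhs x); apply.
  by rewrite divr_gt0// ltr_wpDl.
rewrite ltr_pdivlMr ?ltr_wpDl// => /(le_lt_trans _); apply.
by rewrite mulrC ler_wpM2l// lerDl.
Unshelve. all: by end_near. Qed.

(** [reach r k v] is to be read: starting at level r, the value v occurs at time
    k. Values bounded by their initial level and tending to 0 uniformly over
    bounded initial levels have a common KL bound. The supremum over initial
    levels at most r and times at least t need not be continuous in r; the
    penalty 2 (s - r) admits levels s > r and makes the supremum 2-Lipschitz.
    Since v <= s, the levels above 2 r contribute nothing positive, so that
    the supremum still tends to 0 in t. The term r / (1 + t) makes it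
    strictly increasing. *)
Lemma class_KL_majorant (R : realType) (reach : R -> nat -> R -> Prop) :
  (forall r k v, reach r k v -> 0 <= r /\ v <= r) ->
  (forall r eps, 0 <= r -> 0 < eps -> exists N : nat, forall s k v,
    s <= r -> (N <= k)%N -> reach s k v -> v <= eps) ->
  exists2 b : R -> R -> R, class_KL b &
    forall r k v, reach r k v -> v <= b r k%:R.
Proof.
move=> reach_le reach_attr.
(* The element 0 keeps the set nonempty and the supremum nonnegative. *)
pose F (r t : R) : set R := [set x | x = 0 \/ exists s k v,
  [/\ reach s k v, t <= k%:R & x = v - 2 * Num.max 0 (s - r)]].
pose b (r t : R) : R := sup (F r t).
have F0 r t : F r t 0 by left.
have F_le r t x : 0 <= r -> F r t x -> x <= r.
  move=> r0 [-> //|[s [k [v [/reach_le[s0 vs] _ ->]]]]].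
  have [sr|rs] := leP (s - r) 0; lra.
have supF r t : 0 <= r -> has_sup (F r t).
  by move=> r0; split; [exists 0|exists r; move=> x; exact: F_le].
have b_ge0 r t : 0 <= r -> 0 <= b r t.
  by move=> r0; apply: ub_le_sup => //; exact: (supF r t r0).2.
have b_mono r s t : 0 <= r -> r <= s -> b r t <= b s t.
  move=> r0 rs; apply: ge_sup => [|x [->|]]; [by exists 0| |].
    exact: b_ge0 (le_trans r0 rs).
  move=> [q [k [v [qkv tk ->]]]].
  apply: (@le_trans _ _ (v - 2 * Num.max 0 (q - s))).
    rewrite lerD2l lerN2 ler_pM2l// ge_max le_max lexx/=.
    by rewrite le_max; apply/orP; right; lra.
  apply: ub_le_sup; first exact: (supF s t (le_trans r0 rs)).2.
  by right; exists q, k, v.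
have b_lip r s t : 0 <= r -> r <= s -> b s t <= b r t + 2 * (s - r).
  move=> r0 rs; apply: ge_sup => [|x [->|]]; [by exists 0| |].
    by rewrite addr_ge0 ?b_ge0// mulr_ge0// subr_ge0.
  move=> [q [k [v [qkv tk ->]]]].
  have : v - 2 * Num.max 0 (q - r) <= b r t.
    apply: ub_le_sup; first exact: (supF r t r0).2.
    by right; exists q, k, v.
  have : Num.max 0 (q - r) <= Num.max 0 (q - s) + (s - r).
    rewrite ge_max; apply/andP; split.
      by rewrite addr_ge0 ?subr_ge0// le_max lexx.
    have : q - s <= Num.max 0 (q - s) by rewrite le_max lexx orbT.
    lra.
  lra.
exists (fun r t => b r t + r / (1 + t)).
  split.
  - move=> t t0; have t1 : 0 < 1 + t by rewrite ltr_pwDl.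
    split.
    + apply: (@lipschitz_within_continuous _ _ _ (2 + (1 + t)^-1)).
      move=> x y [x0 _] [y0 _] xy.
      have bm := b_mono x y t x0 xy; have bl := b_lip x y t x0 xy.
      have xyt : 0 <= (y - x) / (1 + t) by rewrite divr_ge0 ?subr_ge0// ltW.
      by rewrite ler_norml; apply/andP; split; nra.
    + move=> r s r0 rs _; apply: ler_ltD; first exact: b_mono (ltW rs).
      by rewrite ltr_pM2r// invr_gt0.
    + rewrite mul0r addr0; apply/eqP; rewrite eq_le b_ge0// andbT.
      by apply: ge_sup => [|x]; [exists 0|exact: F_le].
  - move=> r s t r0 s0 st; apply: lerD.
      apply: ge_sup => [|x Fx]; first by exists 0.
      apply: ub_le_sup; first exact: (supF r s r0).2.
      case: Fx => [->|[q [k [v [qkv tk ->]]]]]; first by left.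
      by right; exists q, k, v; split=> //; exact: le_trans st tk.
    by rewrite ler_wpM2l// lef_pV2 ?posrE ?ltr_pwDl ?lerD2l// (le_trans s0).
  - move=> r r0; apply/cvgrPdist_le => eps eps0.
    have r2 : 0 <= 2 * r by rewrite mulr_ge0.
    have eps2 : 0 < eps / 2 by rewrite divr_gt0.
    have [N NP] := reach_attr (2 * r) (eps / 2) r2 eps2.
    near=> t.
    have t0 : 0 <= t by near: t; apply: nbhs_pinfty_ge; exact: num_real.
    have tN : N%:R <= t by near: t; apply: nbhs_pinfty_ge; exact: num_real.
    have tr : r / (eps / 2) <= t.
      by near: t; apply: nbhs_pinfty_ge; exact: num_real.
    have t1 : 0 < 1 + t by rewrite ltr_pwDl.
    have : b r t <= eps / 2.
      apply: ge_sup => [|x [->|]]; [by exists 0|exact: ltW|].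
      move=> [s [k [v [skv tk ->]]]].
      have [s0 vs] := reach_le _ _ _ skv.
      have max_ge0 : 0 <= Num.max 0 (s - r) by rewrite le_max lexx.
      have [sr|rs] := leP s (2 * r).
        have : v <= eps / 2.
          by apply: NP skv => //; rewrite -(ler_nat R); exact: le_trans tN tk.
        lra.
      have : s - r <= Num.max 0 (s - r) by rewrite le_max lexx orbT.
      lra.
    have : r / (1 + t) <= eps / 2.
      rewrite ler_pdivrMr//; move: tr; rewrite ler_pdivrMr// => tr.
      by apply: le_trans tr _; rewrite mulrC ler_pM2l// lerDr.
    have : 0 <= r / (1 + t) by rewrite divr_ge0// ltW.
    have := b_ge0 r t r0.
    by rewrite sub0r normrN => ? ? ? ?; rewrite ger0_norm; lra.
move=> r k v rkv; have [r0 _] := reach_le _ _ _ rkv.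
apply: ler_wpDr; first by rewrite divr_ge0// addr_ge0.
apply: ub_le_sup; first exact: (supF r _ r0).2.
by right; exists r, k, v; split=> //; rewrite subrr maxxx mulr0 subr0.
Unshelve. all: by end_near. Qed.

(** * One step of perturbed gradient descent *)

(** With s L(J z) <= 1, polarization turns - s <g, u> + L s^2 |u|^2 / 2 into at
    most - s (|g|^2 - |e|^2) / 2. *)
Lemma gd_step_large_gradient (R : realType) (n : nat) (Z : set 'rV[R]_n)
    (J : 'rV[R]_n -> R) (zs : 'rV[R]_n) (L : R -> R) (z e : 'rV[R]_n)
    (eta : R) :
  open Z -> proper_objective Z zs J -> sublevel_lipschitz Z J L ->
  Z z -> 0 < L (J z) -> 0 < eta -> eta <= 1 / L (J z) ->
  enorm e < enorm (grad J z) ->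
  Z (z - eta *: (grad J z + e)) /\
  J (z - eta *: (grad J z + e)) <=
    J z - eta / 2 * (enorm (grad J z) ^+ 2 - enorm e ^+ 2).
Proof.
move=> Zopen [[dJ _] Vsize _ _] Llip Zz L0 eta0 etaL eg.
have eg2 : 0 < enorm (grad J z) ^+ 2 - enorm e ^+ 2.
  by have := enorm_ge0 e; nra.
have polar := dotp_polar (grad J z) e.
have u0 : 0 <= enorm (grad J z + e) ^+ 2 by rewrite sqr_ge0.
have quad s : 0 < s -> s <= eta ->
    - s * dotp (grad J z) (grad J z + e) +
      L (J z) * (s ^+ 2 / 2) * enorm (grad J z + e) ^+ 2 <=
    - (s / 2 * (enorm (grad J z) ^+ 2 - enorm e ^+ 2)).
  move=> s0 seta; have Ls : L (J z) * s <= 1.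
    by rewrite mulrC -ler_pdivlMr//; exact: le_trans seta etaL.
  have : 0 <= s * (1 - L (J z) * s) * enorm (grad J z + e) ^+ 2.
    by apply: mulr_ge0 => //; apply: mulr_ge0; [exact: ltW|rewrite subr_ge0].
  nra.
have [||||[Zz' _] Jz'] := @ray_descent R n Z J zs L (J z) z (grad J z + e) eta
  Zopen dJ Vsize Llip.
- by split.
- exact: ltW.
- move=> s s0 seta; have := quad s s0 seta.
  have : 0 < s / 2 * (enorm (grad J z) ^+ 2 - enorm e ^+ 2).
    by rewrite !mulr_gt0 ?invr_gt0.
  lra.
- by right; lra.
by split=> //; have := quad eta eta0 (lexx _); lra.
Qed.

(** Here J may increase along the step, so the sublevel set of a larger h must
    contain the ray; - <g, u> <= |e|^2 / 2 and |u|^2 <= 4 |e|^2 bound the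
    increase over a step of size at most T. *)
Lemma gd_step_small_gradient (R : realType) (n : nat) (Z : set 'rV[R]_n)
    (J : 'rV[R]_n -> R) (zs : 'rV[R]_n) (L : R -> R) (h T : R)
    (z e : 'rV[R]_n) (eta : R) :
  open Z -> proper_objective Z zs J -> sublevel_lipschitz Z J L ->
  Z z -> 0 <= L h -> 0 <= eta -> eta <= T ->
  enorm (grad J z) <= enorm e ->
  J z + (T / 2 + 2 * L h * T ^+ 2) * enorm e ^+ 2 < h ->
  Z (z - eta *: (grad J z + e)) /\
  J (z - eta *: (grad J z + e)) <=
    J z + (T / 2 + 2 * L h * T ^+ 2) * enorm e ^+ 2.
Proof.
move=> Zopen [[dJ _] Vsize _ _] Llip Zz L0 eta0 etaT ge Jh.
have ge2 : enorm (grad J z) ^+ 2 <= enorm e ^+ 2.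
  by rewrite lerXn2r// nnegrE enorm_ge0.
have polar := dotp_polar (grad J z) e.
have u4 : enorm (grad J z + e) ^+ 2 <= 4 * enorm e ^+ 2.
  by apply: le_trans (enormD_sqr_le _ _) _; lra.
have [g0 u0 e0] : [/\ 0 <= enorm (grad J z) ^+ 2,
    0 <= enorm (grad J z + e) ^+ 2 & 0 <= enorm e ^+ 2].
  by rewrite !sqr_ge0.
have T0 : 0 <= T := le_trans eta0 etaT.
have C0 : 0 <= T / 2 + 2 * L h * T ^+ 2.
  by apply: addr_ge0; [exact: divr_ge0|rewrite mulr_ge0 ?sqr_ge0// mulr_ge0].
have quad s : 0 <= s -> s <= T ->
    - s * dotp (grad J z) (grad J z + e) +
      L h * (s ^+ 2 / 2) * enorm (grad J z + e) ^+ 2 <=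
    (T / 2 + 2 * L h * T ^+ 2) * enorm e ^+ 2.
  move=> s0 sT.
  have lin : - s * dotp (grad J z) (grad J z + e) <= T / 2 * enorm e ^+ 2.
    have : - dotp (grad J z) (grad J z + e) <= enorm e ^+ 2 / 2 by lra.
    nra.
  have : L h * (s ^+ 2 / 2) * enorm (grad J z + e) ^+ 2 <=
      L h * (T ^+ 2 / 2) * (4 * enorm e ^+ 2).
    apply: ler_pM => //; first by rewrite mulr_ge0// divr_ge0// sqr_ge0.
    by apply: ler_wpM2l => //; rewrite ler_pM2r// lerXn2r.
  lra.
have [||||[Zz' _] Jz'] := @ray_descent R n Z J zs L h z (grad J z + e) eta
  Zopen dJ Vsize Llip.
- by split=> //; apply: le_trans (ltW Jh); rewrite lerDl mulr_ge0.
- by [].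
- move=> s s0 seta; have := quad s (ltW s0) (le_trans seta etaT); lra.
- by left; apply: le_lt_trans Jh; rewrite lerDl mulr_ge0.
by split=> //; have := quad eta eta0 etaT; lra.
Qed.

(** The two regimes combined, with a gain function that takes over exactly when
    the gradient no longer dominates the disturbance. The bound 1 on the gain
    confines runs to a sublevel set determined by the initial level alone. *)
Lemma perturbed_gd_step (R : realType) (n : nat) (Z : set 'rV[R]_n)
    (J : 'rV[R]_n -> R) (zs : 'rV[R]_n) (L a5 : R -> R) :
  open Z -> global_minimizer Z J zs -> proper_objective Z zs J ->
  sublevel_lipschitz Z J L ->
  (forall h, J zs <= h -> 0 < L h) ->
  (forall h1 h2, J zs <= h1 -> h1 <= h2 -> L h1 <= L h2) ->
  class_K a5 ->
  (forall z, Z z -> a5 (J z - J zs) <= enorm (grad J z)) ->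
  exists d g, [/\ 0 < d, class_K_on d%:E g,
    forall m, 0 <= m -> m < d -> g m <= 1 &
    forall m z e eta, 0 <= m -> m < d -> Z z -> enorm e <= m ->
      0 < eta -> eta <= 1 / L (J z) ->
      let z' := z - eta *: (grad J z + e) in
      [/\ Z z', J z' - J zs <= Num.max (J z - J zs) (g m) &
        g m < J z - J zs ->
        J z' - J zs <= J z - J zs - 3 / 8 * eta * a5 (J z - J zs) ^+ 2]].
Proof.
move=> Zopen [Zzs Jmin] Jproper Llip Lpos Lmono a5K a5J.
pose T := 1 / L (J zs).
have T0 : 0 < T by rewrite divr_gt0// Lpos.
pose h := J zs + 1.
have Lh0 : 0 < L h by apply: Lpos; rewrite lerDl.
pose C := T / 2 + 2 * L h * T ^+ 2.
have C0 : 0 < C.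
  apply: addr_gt0; first by apply: divr_gt0.
  by apply: mulr_gt0; [exact: mulr_gt0|exact: exprn_gt0].
(* Half of a5: V > p m then yields a gradient larger than 2 m, not merely m. *)
pose a := fun r => a5 r / 2.
have aK : class_K a.
  case: a5K => a5cont a5incr a50; split.
  - by move=> x; apply: cvgM; [exact: a5cont|exact: cvg_cst].
  - by move=> r s r0 rs sy; rewrite /a ltr_pM2r// a5incr.
  - by rewrite /a a50 mul0r.
have half0 : 0 < 2^-1 :> R by rewrite invr_gt0.
have [p [pcont pincr p0] pP] := class_K_inverse aK half0.
(* Below d, p m <= 1/2 and C m^2 < 1/2, so small-gradient steps stay below h. *)
pose d := Num.min (a 2^-1) (Num.min 1 (2 * C)^-1).
have da : d <= a 2^-1 by rewrite ge_min lexx.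
have d1 : d <= 1 by rewrite !ge_min lexx orbT.
have dC : d <= (2 * C)^-1 by rewrite !ge_min lexx !orbT.
have d0 : 0 < d.
  have C20 : 0 < (2 * C)^-1 by rewrite invr_gt0 mulr_gt0.
  rewrite !lt_min ltr01 C20 !andbT.
  by have [_ aincr a0] := aK; rewrite -a0; apply: aincr; rewrite ?ltry.
pose g m := p m + C * m ^+ 2.
have Cm m : 0 <= m -> m < d -> C * m ^+ 2 < 2^-1.
  move=> m0 md; apply: (@le_lt_trans _ _ (C * m)).
    by rewrite ler_pM2l// expr2 ler_piMr// (le_trans (ltW md)).
  have : m < (2 * C)^-1 by exact: lt_le_trans md dC.
  by rewrite invfM ltr_pdivlMr// mulrC.
exists d, g; split=> //.
- split.
  + move=> x; apply: cvgD.
      apply: (continuous_subspaceW _ pcont) => y [/= -> yd] /=; split=> //.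
      by apply: lt_le_trans yd _; rewrite lee_fin.
    apply: (@continuous_subspaceT _ _ _ (fun m : R => C * m ^+ 2)) => {}x.
    by apply: cvgM; [exact: cvg_cst|exact: exprn_continuous].
  + move=> r s r0 rs; rewrite lte_fin => sd; rewrite /g ltrD//.
      by apply: pincr => //; rewrite lte_fin (lt_le_trans sd).
    by rewrite ltr_pM2l// ltrXn2r// nnegrE// ltW// (le_lt_trans r0).
  + by rewrite /g p0 expr0n/= mulr0 addr0.
- move=> m m0 md; have [_ pm _] := pP m m0 (lt_le_trans md da).
  by have := Cm m m0 md; rewrite /g; lra.
move=> m z e eta m0 md Zz em eta0 etaL z'.
have V0 : 0 <= J z - J zs by rewrite subr_ge0; exact: Jmin.
have J0 : J zs <= J z by rewrite -subr_ge0.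
have [pm0 pm1 apm] := pP m m0 (lt_le_trans md da).
have Cm2 : 0 <= C * m ^+ 2 by rewrite mulr_ge0 ?sqr_ge0// ltW.
have [eg|ge] := ltP (enorm e) (enorm (grad J z)).
  have [Zz' Jz'] := gd_step_large_gradient Zopen Jproper Llip Zz (Lpos _ J0)
    eta0 etaL eg.
  have e0 := enorm_ge0 e.
  split=> //.
    rewrite le_max lerD2r; apply/orP; left; apply: le_trans Jz' _.
    rewrite gerBl mulr_ge0// ?divr_ge0 ?ltW// subr_gt0.
    by rewrite ltrXn2r// nnegrE// ltW// (le_lt_trans e0).
  move=> gV.
  have aV : m < a5 (J z - J zs) / 2.
    rewrite -apm ltNge (class_K_mono aK)// -ltNge.
    by apply: le_lt_trans gV; rewrite /g lerDl.
  have a5g := a5J z Zz.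
  have a5g2 : a5 (J z - J zs) ^+ 2 <= enorm (grad J z) ^+ 2.
    by rewrite lerXn2r// nnegrE ?enorm_ge0//; lra.
  have e2g : enorm e ^+ 2 <= (enorm (grad J z) / 2) ^+ 2.
    by rewrite lerXn2r// ?nnegrE//; lra.
  have : eta / 2 * (3 / 4 * a5 (J z - J zs) ^+ 2) <=
         eta / 2 * (enorm (grad J z) ^+ 2 - enorm e ^+ 2).
    by rewrite ler_pM2l ?divr_gt0//; lra.
  rewrite /z'; lra.
have Vp : J z - J zs <= p m.
  rewrite -(class_K_mono aK)// apm /a.
  have := a5J z Zz; lra.
have em2 : C * enorm e ^+ 2 <= C * m ^+ 2.
  by rewrite ler_pM2l// lerXn2r// nnegrE enorm_ge0.
have etaT : eta <= T.
  apply: le_trans etaL _; rewrite /T !div1r lef_pV2 ?posrE ?Lpos//.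
  by apply: Lmono.
have Jh : J z + C * enorm e ^+ 2 < h by have := Cm m m0 md; rewrite /h; lra.
(* Here V z <= p m, so the new gap is at most p m + C m^2 = g m. *)
have [Zz' Jz'] := gd_step_small_gradient Zopen Jproper Llip Zz (ltW Lh0)
  (ltW eta0) etaT ge Jh.
split=> //.
  rewrite le_max; apply/orP; right; apply: le_trans (lerB Jz' (lexx _)) _.
  by rewrite /g -/C; lra.
by move=> /(le_lt_trans (lerD Vp Cm2)); rewrite addr0; rewrite /g; lra.
Qed.

(** * Convergence along runs *)

(** A sequence that cannot cross M upwards and exceeds M at time k has exceeded
    it at all earlier times, so that all the decreases up to k add up. *)
Lemma decrease_to_threshold (R : realType) (v eta : nat -> R) (M c : R) :
  (forall k, v k.+1 <= Num.max (v k) M) ->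
  (forall k, M < v k -> v k.+1 <= v k - c * eta k) ->
  forall k, M < v k -> v k <= v 0%N - c * series eta k.
Proof.
move=> vmax vdec; elim=> [|k IHk] Mv.
  by rewrite /series/= big_geq// mulr0 subr0.
have Mvk : M < v k.
  by have := lt_le_trans Mv (vmax k); rewrite lt_max ltxx orbF.
apply: le_trans (vdec k Mvk) _.
by rewrite seriesSr mulrDr; have := IHk Mvk; lra.
Qed.

Theorem theorem18 (R : realType) (n : nat) (Z : set 'rV[R]_n)
  (J : 'rV[R]_n -> R) (zs : 'rV[R]_n) (L : R -> R) (etamin : R -> nat -> R)
  (Zopen : open Z)
  (Zhomeo : homeomorphic_to_Rn Z)
  (Jmin : unique_global_minimizer Z J zs)
  (Jproper : proper_objective Z zs J)
  (Llip : sublevel_lipschitz Z J L)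
  (Lpos : forall h, J zs <= h -> 0 < L h)
  (Lmono : forall h1 h2, J zs <= h1 -> h1 <= h2 -> L h1 <= L h2)
  (etamin_nonsummable : nonsummable_on_sublevels (J zs) etamin) :
  small_disturbance_ISS Z zs (perturbed_GD Z J L etamin).
Proof.
have [Jmin_zs _] := Jmin.
have [_ Vsize _ [a5 a5K a5J]] := Jproper.
have [d [g [d0 gK g1 step]]] :=
  perturbed_gd_step Zopen Jmin_zs Jproper Llip Lpos Lmono a5K a5J.
pose V z := J z - J zs.
have V_ge0 z : Z z -> 0 <= V z by move=> Zz; rewrite subr_ge0; exact: Jmin_zs.2.
pose RUN x w := [/\ perturbed_GD Z J L etamin x w, Z (x 0%N), linf w
  & linf_norm w < d].
have w_le (w : nat -> 'rV[R]_n) k : linf w -> enorm (w k) <= linf_norm w.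
  by move=> wb; apply: ub_le_sup => //; exists k.
have norm_ge0 (w : nat -> 'rV[R]_n) : linf w -> 0 <= linf_norm w.
  by move=> wb; apply: le_trans (enorm_ge0 (w 0%N)) (w_le w 0%N wb).
have run_inv x w : RUN x w -> forall k, Z (x k) /\
    V (x k) <= Num.max (V (x 0%N)) (g (linf_norm w)).
  move=> [[eta [xS eta0 etaL _]] Zx0 wb wd]; elim=> [|k [Zk Vk]].
    by rewrite le_max lexx.
  have [Zk' Vk' _] := step _ _ _ _ (norm_ge0 w wb) wd Zk (w_le w k wb)
    (eta0 k) (etaL k Zk).
  rewrite xS; split=> //; apply: le_trans Vk' _.
  by rewrite ge_max Vk le_max lexx orbT.
have g_ge0 m : 0 <= m -> m < d -> 0 <= g m.
  have [_ gincr g0] := gK.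
  move=> m0 md; move: m0; rewrite le_eqVlt => /orP[/eqP <-|m0].
    by rewrite g0.
  by rewrite -g0; apply/ltW/gincr; rewrite ?lte_fin.
pose reach r (k : nat) v := exists x w,
  [/\ RUN x w, V (x 0%N) = r & V (x k) - g (linf_norm w) = v].
have [||b bKL reach_b] := @class_KL_majorant R reach.
- move=> r k v [x [w [xw <- <-]]]; have [_ Vk] := run_inv x w xw k.
  have [_ Zx0 wb wd] := xw; have Vx0 := V_ge0 _ Zx0.
  have gw := g_ge0 _ (norm_ge0 w wb) wd.
  split=> //; rewrite lerBlDr; apply: le_trans Vk _.
  by rewrite ge_max lerDl lerDr gw.
- move=> r eps r0 eps0.
  (* All runs from levels at most r stay below h, as the gain is at most 1. *)
  pose h := J zs + (r + 1).
  pose c := 3 / 8 * a5 eps ^+ 2.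
  have a5eps : 0 < a5 eps.
    by have [_ a5incr <-] := a5K; apply: a5incr; rewrite ?ltry.
  have c0 : 0 < c by rewrite mulr_gt0 ?exprn_gt0// divr_gt0.
  have hJ : J zs <= h by rewrite lerDl addr_ge0.
  have /cvgryPge/(_ (r / c)) [N _ NP] := etamin_nonsummable h hJ.
  exists N => s k v sr Nk [x [w [xw Vx0 <-]]].
  have [[eta [xS eta0 etaL etah]] Zx0 wb wd] := xw.
  have m0 := norm_ge0 w wb.
  rewrite leNgt; apply/negP => Vbig.
  pose M := Num.max eps (g (linf_norm w)).
  have Mk : M < V (x k).
    rewrite gt_max; have := g_ge0 _ m0 wd.
    by move=> gw; apply/andP; split; lra.
  have vmax j : V (x j.+1) <= Num.max (V (x j)) M.
    have [Zj _] := run_inv x w xw j.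
    have [_ Vj _] := step _ _ _ _ m0 wd Zj (w_le w j wb) (eta0 j) (etaL j Zj).
    rewrite xS; apply: le_trans Vj _.
    by rewrite ge_max !le_max !lexx !orbT.
  have vdec j : M < V (x j) -> V (x j.+1) <= V (x j) - c * eta j.
    rewrite gt_max => /andP[epsV gV].
    have [Zj _] := run_inv x w xw j.
    have [_ _ Vj] := step _ _ _ _ m0 wd Zj (w_le w j wb) (eta0 j) (etaL j Zj).
    rewrite xS; apply: le_trans (Vj gV) _; rewrite lerD2l lerN2 -/(V (x j)).
    have : a5 eps ^+ 2 <= a5 (V (x j)) ^+ 2.
      rewrite lerXn2r ?nnegrE ?(ltW a5eps)//.
        by apply: le_trans (ltW a5eps) _;
          rewrite (class_K_mono a5K (ltW eps0) (V_ge0 _ Zj)) ltW.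
      by rewrite (class_K_mono a5K (ltW eps0) (V_ge0 _ Zj)) ltW.
    by have := eta0 j; rewrite /c; nra.
  (* A run above M at time k would have used up its whole initial level. *)
  have Vk := decrease_to_threshold vmax vdec Mk.
  have Vr : V (x 0%N) <= r by rewrite Vx0.
  have inh j : sublevel Z J h (x j).
    have [Zj Vj] := run_inv x w xw j; split=> //.
    have : V (x j) <= r + 1.
      apply: le_trans Vj _; rewrite ge_max; apply/andP; split; first lra.
      by apply: le_trans (g1 _ m0 wd) _; lra.
    by rewrite /h /V; lra.
  have le_series : series (etamin h) k <= series eta k.
    by apply: ler_sum => j _; apply: etah => i _; exact: inh.
  have : r <= c * series eta k.
    by rewrite mulrC -ler_pdivrMr//; apply: le_trans (NP k Nk) le_series.
  have : eps < V (x k) by move: Mk; rewrite gt_max => /andP[].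
  lra.
exists V, d%:E, b, g; split=> //.
move=> x w xw Zx0 wb; rewrite lte_fin => wd k.
have run : RUN x w by [].
have [Zk _] := run_inv x w run k; split=> //.
rewrite -lerBlDr; apply: reach_b; by exists x, w.
Qed.
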